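(* Let $G=(V,E)$ be a finite simple graph and let $S\subseteq V$ (the set of vertices chosen by a feasible solution of a relaxation of the fort covering program obtained by omitting fort constraints). Consider the integer program \[\min\sum_{v\in V}x_v\] subject to \[\sum_{v\in V}x_v\ge 1,\] \[x_w-x_v+\sum_{a\in N(w)\setminus\{v\}}x_a\ge 0\quad\text{for all pairs }(v,w)\text{ with }v\in V,\ w\in N(v),\] \[x_v=0\quad\forall v\in \mathrm{cl}(S),\qquad x\in\{0,1\}^V.\] Then this program finds a minimum size violated fort with respect to $S$: an optimal solution is the indicator vector of a fort $B$ of $G$ containing no vertex of $S$, of minimum cardinality among all such forts.
   Context: $N(w)$ denotes the set of neighbors of $w$. A fort of $G$ is a nonempty set $F\subseteq V$ such that no vertex outside $F$ is adjacent to exactly one vertex in $F$. A fort is violated with respect to $S$ if it contains no vertex of $S$. Zero forcing color change rule: a colored vertex with exactly one uncolored neighbor forces that neighbor to become colored; $\mathrm{cl}(S)$ is the set of colored vertices obtained by starting with exactly $S$ colored and applying the rule until no further vertex can be forced. The fort covering program is $\min\sum_{v}s_v$ subject to $\sum_{v\in B}s_v\ge1$ for every fort $B$, $s\in\{0,1\}^V$. *)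

(* Defs.v *)
From mathcomp Require Import all_boot all_order all_algebra.

Set Implicit Arguments.
Unset Strict Implicit.
Unset Printing Implicit Defensive.

Import Order.TTheory GRing.Theory Num.Theory.
Local Open Scope ring_scope.

(* A finite simple graph is a symmetric irreflexive relation e on a finType V;
   both properties are hypotheses of the theorem, not of the definitions. *)

Definition nbhd (V : finType) (e : rel V) (w : V) : {set V} := [set a | e w a].

Definition fort (V : finType) (e : rel V) (F : {set V}) : Prop :=
  F != set0 /\ forall u, u \notin F -> #|nbhd e u :&: F| != 1%N.

Definition violated (V : finType) (S F : {set V}) : Prop := [disjoint F & S].

Definition min_violated_fort (V : finType) (e : rel V) (S B : {set V}) : Prop :=
  [/\ fort e B, violated S B
    & forall F : {set V}, fort e F -> violated S F -> (#|B| <= #|F|)%N].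

Definition forces (V : finType) (e : rel V) (C : {set V}) (v w : V) : bool :=
  (v \in C) && (nbhd e v :\: C == [set w]).

Definition forceable (V : finType) (e : rel V) (C : {set V}) (w : V) : bool :=
  [exists v, forces e C v w].

Definition force_step (V : finType) (e : rel V) (C : {set V}) : {set V} :=
  if [pick w | forceable e C w] is Some w then w |: C else C.

(* Each effective step colors a new vertex, so #|V| steps reach a set where no
   force is possible; zf_closureP below shows that the result does not depend on
   the order in which forces are chosen. *)
Definition zf_closure (V : finType) (e : rel V) (S : {set V}) : {set V} :=
  iter #|V| (force_step e) S.

Inductive reachable (V : finType) (e : rel V) (S : {set V}) : {set V} -> Prop :=
| reachable_start : reachable e S S
| reachable_force C v w :
    reachable e S C -> forces e C v w -> reachable e S (w |: C).

Definition stalled (V : finType) (e : rel V) (C : {set V}) : Prop :=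
  forall v w, ~~ forces e C v w.

Lemma reachable_sub_stalled (V : finType) (e : rel V) (S C D : {set V}) :
  reachable e S C -> S \subset D -> stalled e D -> C \subset D.
Proof.
move=> rC sSD stD; elim: rC => [|{}C v w _ sCD /andP[vC /eqP Nvw]] //.
rewrite subUset sCD andbT sub1set; apply: contraT => wD.
have := stD v w; rewrite /forces (subsetP sCD) //= => /eqP; case.
apply/eqP; rewrite eqEsubset -{1}Nvw setDS //= sub1set inE wD /=.
by have: w \in nbhd e v :\: C by [rewrite Nvw set11]; rewrite inE => /andP[].
Qed.

Lemma reachable_sup (V : finType) (e : rel V) (S C : {set V}) :
  reachable e S C -> S \subset C.
Proof.
by elim=> // {}C v w _ sSC _; apply: (subset_trans sSC); apply: subsetUr.
Qed.

Lemma zf_closure_reachable_stalled (V : finType) (e : rel V) (S : {set V}) :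
  reachable e S (zf_closure e S) /\ stalled e (zf_closure e S).
Proof.
have forceN C w : forceable e C w -> w \notin C.
  case/existsP=> v /andP[_ /eqP Nvw].
  by have: w \in nbhd e v :\: C by [rewrite Nvw set11]; rewrite inE => /andP[].
have key n : reachable e S (iter n (force_step e) S) /\
    (stalled e (iter n (force_step e) S) \/
     (n <= #|iter n (force_step e) S|)%N).
  elim: n => [|n [rC IH]]; first by split; [exact: reachable_start | right].
  rewrite iterS; move: (iter n _ S) rC IH => C rC IH; rewrite /force_step.
  case: pickP => [w fw|nf].
    split; first by case/existsP: (fw) => v; apply: reachable_force.
    case: IH => [st|le]; first by case/existsP: fw => v; rewrite (negPf (st v w)).
    by right; rewrite cardsU1 forceN.
  by split=> //; left=> v w; apply/negP => f; have /existsP[] := nf w; exists v.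
have [r [st|le]] := key #|V|; split=> // v w.
apply/negP => f; have /forceN/negP[] : forceable e (zf_closure e S) w.
  by apply/existsP; exists v.
have /eqP -> : zf_closure e S == setT.
  by rewrite eqEcard subsetT cardsT.
by rewrite inE.
Qed.

Lemma zf_closureP (V : finType) (e : rel V) (S C : {set V}) :
  (reachable e S C /\ stalled e C) <-> C = zf_closure e S.
Proof.
have [rc sc] := zf_closure_reachable_stalled e S.
split=> [[rC sC]|->//]; apply/eqP; rewrite eqEsubset.
by rewrite (reachable_sub_stalled rC (reachable_sup rc) sc)
           (reachable_sub_stalled rc (reachable_sup rC) sC).
Qed.

Definition fort_ip_objective (V : finType) (x : {ffun V -> int}) : int :=
  \sum_v x v.

Definition fort_ip_feasible (V : finType) (e : rel V) (S : {set V})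
    (x : {ffun V -> int}) : Prop :=
  [/\ \sum_v x v >= 1,
      forall v w, w \in nbhd e v ->
        x w - x v + \sum_(a in nbhd e w :\ v) x a >= 0,
      forall v, v \in zf_closure e S -> x v = 0
    & forall v, x v = 0 \/ x v = 1].

Definition fort_ip_optimal (V : finType) (e : rel V) (S : {set V})
    (x : {ffun V -> int}) : Prop :=
  fort_ip_feasible e S x /\
  forall y, fort_ip_feasible e S y ->
    fort_ip_objective x <= fort_ip_objective y.

Definition indicator (V : finType) (B : {set V}) : {ffun V -> int} :=
  [ffun v => (v \in B)%:R].

(* Main.v *)
Require Import Defs.
From mathcomp Require Import all_boot all_order all_algebra.

(** For 0/1 vectors, [x_w - x_v + sum_{a in N(w) \ v} x_a >= 0] says that if [v] is in
    the support [B] and its neighbor [w] is not, then [w] has a second neighbor in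
    [B]; hence these constraints are exactly the fort condition. A fort avoiding [S]
    also avoids [cl(S)], since the first vertex of the fort to be forced would be the
    only neighbor in the fort of a vertex outside it. So feasible points are exactly
    the indicators of violated forts, and the objective is their cardinality. *)

Import Order.TTheory GRing.Theory Num.Theory.
Local Open Scope ring_scope.

Lemma sum_indicator (V : finType) (A B : {set V}) :
  \sum_(a in A) indicator B a = #|A :&: B|%:R.
Proof.
rewrite -sum1_card natr_sum [RHS]big_mkcond /=.
rewrite big_mkcond; apply: eq_bigr => a _.
by rewrite ffunE inE; case: (a \in A); case: (a \in B).
Qed.

Lemma fort_ip_objective_indicator (V : finType) (B : {set V}) :
  fort_ip_objective (indicator B) = #|B|%:R.
Proof.
rewrite /fort_ip_objective -[B in RHS]setTI -sum_indicator.
by apply: eq_bigl => a; rewrite inE.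
Qed.

Lemma fort_disjoint_reachable (V : finType) (e : rel V) (S F C : {set V}) :
  fort e F -> violated S F -> reachable e S C -> [disjoint F & C].
Proof.
move=> [_ fortF] dFS; elim=> // {}C v w _ dFC /andP[vC /eqP Nvw].
rewrite disjoints_subset setCU subsetI -!disjoints_subset dFC andbT.
rewrite disjoint_sym disjoints1; apply/negP => wF.
have vF : v \notin F by rewrite (disjointFl dFC vC).
have := fortF v vF; suff -> : nbhd e v :&: F = [set w] by rewrite cards1.
(* As [F] misses [C], intersecting [N(v)] with [F] loses nothing when [C] is removed first, and
   [N(v)] minus [C] is just [w]. *)
have FC : F :\: C = F by apply/setDidPl.
by rewrite -FC setIDA -setIDAC Nvw; apply/setIidPl; rewrite sub1set.
Qed.

Lemma fort_ip_feasible_indicator (V : finType) (e : rel V) (S B : {set V}) :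
  symmetric e ->
  fort_ip_feasible e S (indicator B) <-> fort e B /\ violated S B.
Proof.
move=> e_sym; have [rcl _] := zf_closure_reachable_stalled e S; split.
  case=> B1 cons clB _; split; last first.
    (* [S] lies in its closure, on which the indicator is required to vanish. *)
    rewrite /violated disjoint_sym disjoint_subset; apply/subsetP => v vS.
    have := clB v (subsetP (reachable_sup rcl) v vS).
    by rewrite ffunE inE; case: (v \in B).
  split=> [|w wB].
    by move: B1; rewrite -/(fort_ip_objective _) fort_ip_objective_indicator
      -card_gt0 ler1n.
  apply/negP => /cards1P[v NwB].
  have /setIP[Nwv vB] : v \in nbhd e w :&: B by rewrite NwB set11.
  have Nvw : w \in nbhd e v by rewrite inE e_sym; rewrite inE in Nwv.
  (* With [v] the only neighbor of [w] in [B], the constraint for [(v, w)] would read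
     [0 - 1 + 0 >= 0]. *)
  have := cons v w Nvw.
  rewrite sum_indicator !ffunE vB (negPf wB).
  by rewrite setIDAC NwB setDv cards0.
case=> fortB dBS; have dBcl := fort_disjoint_reachable _ _ _ _ _ fortB dBS rcl.
case: fortB => B0 fortB; split=> [|v w Nvw|v vcl|v].
- by rewrite -/(fort_ip_objective _) fort_ip_objective_indicator ler1n card_gt0.
- rewrite sum_indicator !ffunE.
  (* If [w] is in [B], then [x_w = 1] already offsets [x_v]. *)
  have [wB|wB] := boolP (w \in B).
    by rewrite addr_ge0 // subr_ge0 ler_nat leq_b1.
  have [vB|vB] := boolP (v \in B); last by rewrite subr0 add0r.
  (* The number of neighbors of [w] in [B] is nonzero because of [v] and is not 1 by the fort
     property, so one remains after removing [v]. *)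
  have vNw : v \in nbhd e w :&: B by rewrite !inE vB e_sym andbT; rewrite inE in Nvw.
  rewrite sub0r addrC subr_ge0 ler1n setIDAC.
  by have := fortB w wB; rewrite (cardsD1 v) vNw; case: #|_|.
- by rewrite ffunE (disjointFl dBcl vcl).
- by rewrite ffunE; case: (v \in B); [right | left].
Qed.

(** A 0/1 vector is determined by its support; this turns arbitrary competitors in the program into
    sets. *)
Lemma fort_ip_feasible_is_indicator (V : finType) (e : rel V) (S : {set V})
    (x : {ffun V -> int}) :
  fort_ip_feasible e S x -> x = indicator [set v | x v == 1].
Proof.
by case=> _ _ _ x01; apply/ffunP => v; rewrite ffunE inE; case: (x01 v) => ->.
Qed.

Lemma fort_ip_optimal_indicator (V : finType) (e : rel V) (S B : {set V}) :
  symmetric e ->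
  fort_ip_optimal e S (indicator B) <-> min_violated_fort e S B.
Proof.
move=> e_sym; have feasP F := fort_ip_feasible_indicator V e S F e_sym.
split=> [[/feasP[fB vB] opt]|[fB vB minB]].
  split=> // F fF vF.
  by have := opt _ ((feasP F).2 (conj fF vF)); rewrite !fort_ip_objective_indicator ler_nat.
split=> [|y feas_y]; first exact/feasP.
have yE := fort_ip_feasible_is_indicator _ _ _ _ feas_y.
move: feas_y; rewrite yE => /feasP[fF vF].
by rewrite !fort_ip_objective_indicator ler_nat minB.
Qed.

Lemma min_violated_fort_exists (V : finType) (e : rel V) (S F : {set V}) :
  fort e F -> violated S F -> exists B, min_violated_fort e S B.
Proof.
(* Boolean form of being a violated fort, so that a smallest one can be picked among the finitely
   many subsets of [V]. *)
pose P (A : {set V}) := [&& A != set0,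
  [forall u, (u \notin A) ==> (#|nbhd e u :&: A| != 1%N)] & [disjoint A & S]].
have PP A : reflect (fort e A /\ violated S A) (P A).
  apply: (iffP and3P) => [[A0 /forallP fA dA]|[[A0 fA] dA]].
    by split=> //; split=> // u; apply/implyP.
  by split=> //; apply/forallP => u; apply/implyP/fA.
move=> fF vF; have PF : P F by apply/PP.
case: (arg_minnP (fun A : {set V} => #|A|) PF) => B /PP[fB vB] minB.
by exists B; split=> // A fA vA; apply/minB/PP.
Qed.

(** Existence of an optimum is conditional because the program is infeasible when no fort is
    violated, for instance when [S] is all of [V]. *)
Theorem theorem6 (V : finType) (e : rel V)
    (e_sym : symmetric e) (e_irr : irreflexive e) (S : {set V}) :
  ((exists F : {set V}, fort e F /\ violated S F) ->
    exists x : {ffun V -> int}, fort_ip_optimal e S x) /\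
  (forall x : {ffun V -> int}, fort_ip_optimal e S x ->
    exists B : {set V}, x = indicator B /\ min_violated_fort e S B).
Proof.
split=> [[F [fF vF]]|x opt].
  have [B minB] := min_violated_fort_exists _ _ _ _ fF vF.
  by exists (indicator B); apply/fort_ip_optimal_indicator.
have xE := fort_ip_feasible_is_indicator _ _ _ _ opt.1.
exists [set v | x v == 1]; split=> //.
by apply/(fort_ip_optimal_indicator _ _ _ _ e_sym); rewrite -xE.
Qed.
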